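(* Let $S=\bigcup_{j=1}^\infty[\gamma_j,\gamma_j+1]=\Gamma+[0,1]$, where $\Gamma=\{\gamma_j:j\in\mathbb{N}\}\subset\mathbb{R}$ and $\xi_j:=\gamma_{j+1}-\gamma_j-1\in[2,3]$ for all $j\in\mathbb{N}$. Assume that $\Gamma$ satisfies property (C). Then for every $\alpha>1/2$, no uniformly discrete set $\Lambda\subset\mathbb{R}$ is a uniqueness set for $W^{(\alpha)}_S$.
   Context: Property (C) of a set $\Gamma$: for every $m\in\mathbb{N}$ there are rationally independent numbers $q_1,\dots,q_m$ such that for every $N\in\mathbb{N}$ there exist $a_1,\dots,a_m$ with $\bigcup_{j=1}^m\{a_j+q_j,a_j+2q_j,\dots,a_j+Nq_j\}\subset\Gamma$. Fourier transform: $\hat f(t)=\int e^{-2\pi i t x}f(x)\,dx$. For $\alpha>1/2$, $W^{(\alpha)}_S$ is the space of functions $f$ whose Fourier transform $F=\hat f$ satisfies $\int_{\mathbb{R}}(1+|t|^{2\alpha})|F(t)|^2\,dt<\infty$ and $F=0$ a.e. outside $S$ (such $f$ are continuous). A set $\Lambda$ is uniformly discrete if $\inf\{|\lambda-\lambda'|:\lambda\neq\lambda'\in\Lambda\}>0$. $\Lambda$ is a uniqueness set for a space of continuous functions if the only function in it vanishing on $\Lambda$ is zero. *)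

(* Defs.v *)
(* R : realType. Complex values are represented by
   pairs of real functions (real part, imaginary part). *)
From HB Require Import structures.
From mathcomp Require Import all_boot all_order all_algebra.
From mathcomp Require Import all_classical all_reals all_analysis.
Set Implicit Arguments. Unset Strict Implicit. Unset Printing Implicit Defensive.
Import Order.TTheory GRing.Theory Num.Theory.
Import numFieldNormedType.Exports.
Local Open Scope classical_set_scope.
Local Open Scope ring_scope.

Section Defs.
Variable R : realType.

Definition setS (gamma : nat -> R) : set R :=
  [set t | exists j, gamma j <= t <= gamma j + 1].

Definition rat_indep (m : nat) (q : 'I_m -> R) : Prop :=
  forall c : 'I_m -> rat, \sum_(i < m) ratr (c i) * q i = 0 -> forall i, c i = 0.

Definition propC (Gamma : set R) : Prop :=
  forall m : nat, exists q : 'I_m -> R, rat_indep q /\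
    forall N : nat, exists a : 'I_m -> R,
      forall (j : 'I_m) (k : nat), (1 <= k <= N)%N -> Gamma (a j + k%:R * q j).

Definition uniformly_discrete (L : set R) : Prop :=
  exists delta : R, 0 < delta /\
    forall x y, L x -> L y -> x != y -> delta <= `|x - y|.

(* f = fr + i fi belongs to W^(alpha)_S: f is the inverse Fourier transform
   f(x) = \int F(t) e^{2 pi i t x} dt of some F = Fr + i Fi with
   \int (1+|t|^{2 alpha}) |F t|^2 dt < oo and F = 0 a.e. outside S. *)
Definition in_W (alpha : R) (S : set R) (fr fi : R -> R) : Prop :=
  exists Fr Fi : R -> R,
    measurable_fun setT Fr /\ measurable_fun setT Fi /\
    (\int[lebesgue_measure]_t
        ((1 + `|t| `^ (2 * alpha)) * (Fr t ^+ 2 + Fi t ^+ 2))%:E < +oo)%E /\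
    {ae lebesgue_measure, forall t, ~ S t -> Fr t = 0 /\ Fi t = 0} /\
    forall x,
      fr x = Rintegral lebesgue_measure setT
               (fun t => Fr t * cos (2 * pi * t * x) - Fi t * sin (2 * pi * t * x)) /\
      fi x = Rintegral lebesgue_measure setT
               (fun t => Fr t * sin (2 * pi * t * x) + Fi t * cos (2 * pi * t * x)).

Definition uniqueness_set (alpha : R) (S : set R) (L : set R) : Prop :=
  forall fr fi : R -> R, in_W alpha S fr fi ->
    (forall x, L x -> fr x = 0 /\ fi x = 0) ->
    forall x, fr x = 0 /\ fi x = 0.

End Defs.

(* Main.v *)
Require Import Defs.
From HB Require Import structures.
From mathcomp Require Import all_boot all_order all_algebra.
From mathcomp Require Import all_classical all_reals all_analysis.
From mathcomp Require Import measurable_realfun complex ring lra.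
Import Order.TTheory GRing.Theory Num.Theory.
Import numFieldNormedType.Exports.
Local Open Scope classical_set_scope.
Local Open Scope ring_scope.
Local Open Scope complex_scope.
Set Implicit Arguments. Unset Strict Implicit. Unset Printing Implicit Defensive.

(** Adjoin to L a point x0 so that the union is still delta-separated; it is
    enough to find f in the space with f x0 = 1 and f = 0 on L.  Averaging the
    exponentials whose frequencies are the points a_j + k q_j of Gamma
    (j < m, 1 <= k <= N) and multiplying by the transform of a bump on [0, 1]
    (which is O(x^-2)) gives a g with g 0 = 1 and spectrum in S.  By rational
    independence, for delta <= |x| <= X at most one q_j x can be close to an
    integer, so at most one of the m geometric sums over k is not small; hence,
    for X, then m, then N large, the values |g y| sum to at most 1/2 over every
    delta-separated set of points |y| >= delta.  The matrix g (x - y), indexed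
    by the points of the separated set, is then a perturbation of the identity
    on l^1, and can be inverted by successive approximation: each step corrects
    the residual at finitely many points and multiplies its l^1 norm by at most
    3/4.  The coefficients being summable, the limit is the transform of the
    compactly supported spectrum of g times a bounded function. *)

Local Notation Re := complex.Re.
Local Notation Im := complex.Im.

(** * Complex exponentials and the transform of a bump *)

Section ComplexExponential.
Variable R : realType.
Implicit Types (x y w a b t : R) (z : R[i]).

(** The l^1 norm of the pair of parts: a real-valued, submultiplicative substitute for the modulus,
    whose bounds split into bounds on real and imaginary parts. The price is that points of the unit
    circle are bounded by 2 instead of 1. *)
Definition cnorm1 z : R := `|Re z| + `|Im z|.

Lemma cnorm1_ge0 z : 0 <= cnorm1 z.
Proof. by rewrite addr_ge0. Qed.

Lemma cnorm10 : cnorm1 0 = 0.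
Proof. by rewrite /cnorm1 /= normr0 addr0. Qed.

Lemma cnorm1D z1 z2 : cnorm1 (z1 + z2) <= cnorm1 z1 + cnorm1 z2.
Proof.
case: z1 z2 => [a b] [c d]; rewrite /cnorm1 /=.
have := ler_normD a c; have := ler_normD b d; lra.
Qed.

Lemma cnorm1N z : cnorm1 (- z) = cnorm1 z.
Proof. by case: z => a b; rewrite /cnorm1 /= !normrN. Qed.

Lemma cnorm1M z1 z2 : cnorm1 (z1 * z2) <= cnorm1 z1 * cnorm1 z2.
Proof.
case: z1 z2 => [a b] [c d]; rewrite /cnorm1 /=.
have := ler_normB (a * c) (b * d); have := ler_normD (a * d) (b * c).
rewrite !normrM; lra.
Qed.

Lemma cnorm1Z a z : cnorm1 (a%:C * z) = `|a| * cnorm1 z.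
Proof.
by case: z => c d; rewrite /cnorm1 /= !mul0r subr0 addr0 !normrM -mulrDr.
Qed.

Lemma cnorm1_sum (I : Type) (r : seq I) (P : pred I) (F : I -> R[i]) :
  cnorm1 (\sum_(i <- r | P i) F i) <= \sum_(i <- r | P i) cnorm1 (F i).
Proof.
elim/big_rec2: _ => [|i y1 y2 _ le12]; first by rewrite cnorm10.
by rewrite (le_trans (cnorm1D _ _))// lerD2l.
Qed.

Definition cexp x : R[i] := cos (2 * pi * x) +i* sin (2 * pi * x).

Lemma cexpD x y : cexp (x + y) = cexp x * cexp y.
Proof.
rewrite /cexp mulrDr cosD sinD; apply/eqP; rewrite eq_complex /= eqxx /=.
by apply/eqP; ring.
Qed.

Lemma cexp0 : cexp 0 = 1.
Proof. by rewrite /cexp mulr0 cos0 sin0. Qed.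

Lemma cnorm1_cexp x : cnorm1 (cexp x) <= 2.
Proof.
rewrite /cnorm1 /=.
have := sin_max (2 * pi * x); have := cos_max (2 * pi * x); lra.
Qed.

(** Mean value theorem on [0, w]; negative w follows by parity. *)
Lemma sin_cosB1_le w : `|sin w| <= `|w| /\ `|cos w - 1| <= `|w|.
Proof.
wlog w0 : w / 0 <= w => [hw|].
  case: (leP 0 w) => [/hw//|/ltW w0].
  by have := hw (- w); rewrite sinN cosN !normrN oppr_ge0 => /(_ w0).
split.
  have [c _] := @MVT_segment R sin cos 0 w w0
    (fun x _ => is_derive_sin x) (continuous_subspaceT (@continuous_sin R)).
  rewrite sin0 !subr0 => ->; rewrite normrM ler_piMl//; exact: cos_max.
have [c _] := @MVT_segment R cos (fun x => - sin x) 0 w w0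
    (fun x _ => is_derive_cos x) (continuous_subspaceT (@continuous_cos R)).
rewrite cos0 !subr0 => ->; rewrite normrM ler_piMl// normrN; exact: sin_max.
Qed.

(** Lets the continuity of an explicit formula follow from instance inference on [is_derive]. *)
Lemma is_derive_continuous (F f : R -> R) :
  (forall x, is_derive x (1 : R) F (f x)) -> continuous F.
Proof.
move=> dF x; apply: differentiable_continuous; apply/derivable1_diffP.
by have [] := dF x.
Qed.

Lemma Rintegral_antiderivative (F f : R -> R) a b : a < b ->
  (forall x, is_derive x (1 : R) F (f x)) -> continuous f ->
  Rintegral lebesgue_measure `[a, b] f = F b - F a.
Proof.
move=> ab dF cf; have cF := is_derive_continuous dF.
rewrite /Rintegral (@continuous_FTC2 R f F a b)//.
- exact: continuous_subspaceT.
- split => [x _||].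
  + by have [] := dF x.
  + exact/cvg_at_right_filter/cF.
  + exact/cvg_at_left_filter/cF.
- by move=> x _; rewrite derive1E; have [_] := dF x.
Qed.

(** The parabola vanishes at both ends of its interval, so its transform is of order y^-2, which is
    summable over separated points away from 0. *)
Definition bump b t : R := (t - b) * (b + 1 - t) * \1_(`[b, b + 1]%classic : set R) t.

Lemma bump_itv b (f : R -> R) :
  Rintegral lebesgue_measure setT (fun t => bump b t * f t) =
  Rintegral lebesgue_measure `[b, b + 1]
     (fun t => (t - b) * (b + 1 - t) * f t).
Proof.
rewrite [RHS]Rintegral_mkcond; apply: eq_Rintegral => t _.
rewrite /bump patchE indicE; case: ifP => _ /=; last by rewrite mulr0 mul0r.
by rewrite mulr1.
Qed.

(* The inverse Fourier transform of t (1 - t) on [0, 1], where w = 2 pi y. *)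
Definition bumpFT y : R[i] := let w := 2 * pi * y in
  if y == 0 then (6^-1)%:C else
  (- (cos w + 1) / w ^+ 2 + 2 * sin w / w ^+ 3) +i*
  (- sin w / w ^+ 2 - 2 * (cos w - 1) / w ^+ 3).

Lemma bumpFT0 : bumpFT 0 = (6^-1)%:C.
Proof. by rewrite /bumpFT eqxx. Qed.

(** Both |sin w| and |cos w - 1| are at most |w|, so each of the four terms is at most 2 / w^2; and
    8 / w^2 <= y^-2 because pi >= 2. *)
Lemma cnorm1_bumpFT y : y != 0 -> cnorm1 (bumpFT y) <= y ^- 2.
Proof.
move=> y0; rewrite /bumpFT (negbTE y0); set w := 2 * pi * y.
have pi0 : 2 <= pi :> R := pi_ge2 R.
have w0 : w != 0 by rewrite !mulf_neq0// gt_eqF// pi_gt0.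
have [sw cw] := sin_cosB1_le w.
have nw : 0 < `|w| by rewrite normr_gt0.
have q (v : R) : `|v| <= `|w| -> `|2 * v / w ^+ 3| <= 2 / w ^+ 2.
  move=> zw; rewrite !normrM normfV normrX (ger0_norm (ler0n _ 2)).
  have -> : w ^+ 2 = `|w| ^+ 2 by rewrite real_normK ?num_real.
  rewrite -mulrA ler_pM2l// ler_pdivrMr ?exprn_gt0//.
  by rewrite (_ : _ * _ = `|w|)//; field; rewrite gt_eqF.
have h (v : R) : `|v| <= 2 -> `|- v / w ^+ 2| <= 2 / w ^+ 2.
  move=> zw; rewrite normrM normfV normrX normrN real_normK ?num_real//.
  by rewrite ler_pM2r// invr_gt0 exprn_even_gt0.
have w2 : 8 / w ^+ 2 <= y ^- 2.
  have -> : w ^+ 2 = 4 * pi ^+ 2 * y ^+ 2 by rewrite /w; ring.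
  rewrite invfM mulrA ler_piMl ?invr_ge0 ?sqr_ge0// ler_pdivrMr ?mul1r; nra.
have h1 := h (cos w + 1) _; have h2 := h (sin w) _.
have h3 := q _ sw; have h4 := q _ cw.
have cm := cos_max w; have sm := sin_max w.
rewrite /cnorm1 /=.
have := ler_normD (- (cos w + 1) / w ^+ 2) (2 * sin w / w ^+ 3).
have := ler_normB (- sin w / w ^+ 2) (2 * (cos w - 1) / w ^+ 3).
have := h1 _; have := h2 _.
have -> : `|cos w + 1| <= 2 by have := ler_normD (cos w) 1; rewrite normr1; lra.
have -> : `|sin w| <= 2 by lra.
move=> /(_ isT) ? /(_ isT) ?; lra.
Qed.

Lemma Rintegral_bump b y :
  Rintegral lebesgue_measure setT (fun t => bump b t * cos (2 * pi * t * y))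
    = Re (cexp (b * y) * bumpFT y) /\
  Rintegral lebesgue_measure setT (fun t => bump b t * sin (2 * pi * t * y))
    = Im (cexp (b * y) * bumpFT y).
Proof.
have bb : b < b + 1 by rewrite ltrDl.
set w := 2 * pi * y.
have wE t : 2 * pi * t * y = w * t by rewrite /w; ring.
under eq_Rintegral do rewrite wE.
under [X in _ /\ X = _]eq_Rintegral do rewrite wE.
have cc : continuous (fun t => (t - b) * (b + 1 - t) * cos (w * t)).
  by apply: is_derive_continuous => x; apply: is_derive_eq.
have cs : continuous (fun t => (t - b) * (b + 1 - t) * sin (w * t)).
  by apply: is_derive_continuous => x; apply: is_derive_eq.
rewrite !bump_itv /bumpFT -/w; have [y0|y0] := eqVneq y 0.
  have w0 : w = 0 by rewrite /w y0 mulr0.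
  rewrite y0 !mulr0 cexp0 mul1r /=; split.
  - pose F t : R := 2^-1 * (t - b) ^+ 2 - 3^-1 * (t - b) ^+ 3.
    have dF x : is_derive x (1 : R) F ((x - b) * (b + 1 - x) * cos (w * x)).
      by apply: is_derive_eq; rewrite w0 mul0r cos0 /GRing.scale /=; field.
    by rewrite (Rintegral_antiderivative bb dF cc) /F; field.
  - have dF x : is_derive x (1 : R) (cst 0) ((x - b) * (b + 1 - x) * sin (w * x)).
      by apply: is_derive_eq; rewrite w0 mul0r sin0 mulr0.
    by rewrite (Rintegral_antiderivative bb dF cs) /cst subrr.
have w0 : w != 0 by rewrite !mulf_neq0// gt_eqF// pi_gt0.
have bE : 2 * pi * (b * y) = w * b by rewrite /w; ring.
have b1E : w * (b + 1) = w * b + w by ring.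
split.
(* With P = (t - b) (b + 1 - t), so that P'' = -2, repeated integration by parts gives P sin / w +
   P' cos / w^2 - P'' sin / w^3. The sine integral below is analogous. *)
- pose F t : R := w^-1 * ((t - b) * (b + 1 - t) * sin (w * t)) +
     w ^- 2 * ((b + 1 - t - (t - b)) * cos (w * t)) + 2 * w ^- 3 * sin (w * t).
  have dF x : is_derive x (1 : R) F ((x - b) * (b + 1 - x) * cos (w * x)).
    by apply: is_derive_eq; rewrite /GRing.scale /=; field.
  rewrite (Rintegral_antiderivative bb dF cc) /F /= bE.
  by rewrite b1E sinD cosD; field.
- pose F t : R := - w^-1 * ((t - b) * (b + 1 - t) * cos (w * t)) +
     w ^- 2 * ((b + 1 - t - (t - b)) * sin (w * t)) - 2 * w ^- 3 * cos (w * t).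
  have dF x : is_derive x (1 : R) F ((x - b) * (b + 1 - x) * sin (w * x)).
    by apply: is_derive_eq; rewrite /GRing.scale /=; field.
  rewrite (Rintegral_antiderivative bb dF cs) /F /= bE.
  by rewrite b1E sinD cosD; field.
Qed.

End ComplexExponential.

(** * Sums over separated sets *)

Section SeparatedSums.
Variable R : realType.
Implicit Types (delta X : R) (s : seq R).

(* Telescoping: y ^- 2 <= delta^-1 * ((y - delta/2)^-1 - (y + delta/2)^-1). *)
Lemma sum_inv_sqr_sorted delta X s : 0 < delta -> delta <= X ->
  sorted <=%R s -> uniq s ->
  (forall x y, x \in s -> y \in s -> x != y -> delta <= `|x - y|) ->
  (forall y, y \in s -> X <= y) ->
  \sum_(y <- s) y ^- 2 <= (delta * (X - delta / 2))^-1.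
Proof.
move=> d0; elim: s X => [|y s IHs] X dX /=.
  by move=> *; rewrite big_nil invr_ge0 mulr_ge0 ?subr_ge0//; lra.
rewrite (path_sortedE le_trans) => /andP[/allP ys srt] /andP[yNs us] sep Xs.
have Xy : X <= y by apply: Xs; rewrite mem_head.
have yd z : z \in s -> y + delta <= z.
  move=> zs; have yz := ys _ zs.
  have /sep : y \in y :: s by rewrite mem_head.
  move=> /(_ z); rewrite in_cons zs orbT => /(_ isT).
  have -> : y != z by apply: contraNneq yNs => ->.
  by move=> /(_ isT); rewrite distrC ger0_norm ?subr_ge0//; lra.
have IH := IHs (y + delta) _ srt us _ yd.
rewrite big_cons.
apply: (@le_trans _ _ (y ^- 2 + (delta * (y + delta - delta / 2))^-1)).
  rewrite lerD2l; apply: IH => [|a b as_ bs]; first lra.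
  by apply: sep; rewrite in_cons ?as_ ?bs orbT.
apply: (@le_trans _ _ (delta * (y - delta / 2))^-1); last first.
  rewrite lef_pV2 ?posrE ?mulr_gt0// ?ler_pM2l//; lra.
rewrite -subr_ge0.
have h1 : 0 < y by lra.
have h2 : 0 < y - delta / 2 by lra.
have h3 : 0 < y + delta / 2 by lra.
rewrite (_ : _ - _ = (delta / 2) ^+ 2 /
   (y ^+ 2 * (y - delta / 2) * (y + delta / 2))).
  by rewrite divr_ge0 ?sqr_ge0// !mulr_ge0// ltW.
field; rewrite !gt_eqF//; lra.
Qed.

(** Sorting reduces this to the telescoped bound, and X - delta / 2 is at least X / 2. *)
Lemma sum_inv_sqr_separated_ge delta X s : 0 < delta -> delta <= X ->
  uniq s ->
  (forall x y, x \in s -> y \in s -> x != y -> delta <= `|x - y|) ->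
  (forall y, y \in s -> X <= y) ->
  \sum_(y <- s) y ^- 2 <= 2 / (delta * X).
Proof.
move=> d0 dX us sep Xs.
rewrite -(perm_big _ (permEl (perm_sort <=%R s))) /=.
apply: (@le_trans _ _ (delta * (X - delta / 2))^-1).
  apply: sum_inv_sqr_sorted => //.
  - exact: (sort_sorted le_total).
  - by rewrite sort_uniq.
  - by move=> x y; rewrite !mem_sort; apply: sep.
  - by move=> y; rewrite mem_sort; apply: Xs.
rewrite -[leLHS]mul1r ler_pdivrMr ?mulr_gt0//; last lra.
rewrite [leRHS](_ : _ = 2 * (X - delta / 2) / X); last first.
  by field; rewrite !gt_eqF//; lra.
by rewrite ler_pdivlMr ?mul1r; lra.
Qed.

(** Nonnegative and negative points are bounded separately, the latter after reflection. *)
Lemma sum_inv_sqr_separated delta X s : 0 < delta -> delta <= X ->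
  uniq s ->
  (forall x y, x \in s -> y \in s -> x != y -> delta <= `|x - y|) ->
  \sum_(y <- s | X <= `|y|) y ^- 2 <= 4 / (delta * X).
Proof.
move=> d0 dX us sep.
have X0 : 0 < X by lra.
rewrite (bigID (fun y => 0 <= y)) /= (_ : 4 = 2 + 2 :> R); last by ring.
rewrite [leRHS]mulrDl; apply: lerD.
  rewrite -big_filter; apply: sum_inv_sqr_separated_ge => //.
  - by rewrite filter_uniq.
  - by move=> x y; rewrite !mem_filter => /andP[_ xs] /andP[_ ys]; apply: sep.
  - by move=> y; rewrite mem_filter => /andP[/andP[+ y0] _]; rewrite ger0_norm.
rewrite -big_filter; set s' := seq.filter _ _.
rewrite (_ : \sum_(y <- s') _ = \sum_(y <- map -%R s') y ^- 2); last first.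
  by rewrite big_map; apply: eq_bigr => y _; rewrite sqrrN.
apply: sum_inv_sqr_separated_ge => //.
- by rewrite (map_inj_uniq oppr_inj) filter_uniq.
- move=> _ _ /mapP[x + ->] /mapP[y + ->]; rewrite !mem_filter.
  move=> /andP[_ xs] /andP[_ ys]; rewrite eqr_opp -opprD normrN; exact: sep.
- move=> _ /mapP[y + ->]; rewrite mem_filter -ltNge => /andP[/andP[+ y0] _].
  by rewrite ltr0_norm.
Qed.

End SeparatedSums.

(** * Exponential sums with rationally independent steps *)

Section ExponentialSums.
Variable R : realType.
Implicit Types (x y delta X theta : R).

Lemma cexp_nat (n : nat) : cexp n%:R = 1 :> R[i].
Proof.
elim: n => [|n IHn]; first exact: cexp0.
rewrite -natr1 cexpD IHn mul1r /cexp mulr1 mulrC mulr_natr cos2pi sin2pi.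
by apply/eqP; rewrite eq_complex /= !eqxx.
Qed.

Lemma cexp_int (k : int) : cexp k%:~R = 1 :> R[i].
Proof.
case: k => n; first exact: cexp_nat.
by rewrite NegzE mulrNz -[LHS]mulr1 -[in LHS](cexp_nat n.+1) -cexpD addNr cexp0.
Qed.

(** For the fractional part r of y, cos (2 pi r) = 1 forces sin (pi r) = 0, whereas sin is positive
    strictly between 0 and pi. *)
Lemma cos_2pi_eq1 y : cos (2 * pi * y) = 1 -> exists k : int, y = k%:~R.
Proof.
move=> cy1; exists (Num.floor y); set k := Num.floor y.
have ky := floor_le_tmp y; have yk := floorD1_gt y; rewrite -/k in ky yk.
rewrite intrD in yk.
have : cexp y = cexp (y - k%:~R).
  by rewrite -[RHS]mulr1 -(cexp_int k) -cexpD subrK.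
case=> + _; rewrite cy1; set r := y - k%:~R.
rewrite (_ : 2 * pi * r = pi * r + pi * r); last by ring.
rewrite cosD -!expr2; have := cos2Dsin2 (pi * r) => c2s2 c1.
have : sin (pi * r) ^+ 2 = 0 by lra.
move/eqP; rewrite sqrf_eq0 => /eqP s0.
have [r0|r0] := eqVneq r 0; first by apply/eqP; rewrite -subr_eq0 -/r r0.
have rp : 0 < r by rewrite lt_neqAle eq_sym r0 subr_ge0.
have p0 := pi_gt0 R; have : 0 < sin (pi * r).
  apply: sin_gt0_pi; rewrite mulr_gt0//= -[ltRHS]mulr1 ltr_pM2l// /r; lra.
by rewrite s0 ltxx.
Qed.

Lemma cexp_geometric y (n : nat) :
  (cexp y - 1) * \sum_(1 <= k < n.+1) cexp (k%:R * y) = cexp (n.+1%:R * y) - cexp y.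
Proof.
elim: n => [|n IHn]; first by rewrite big_geq// mulr0 mul1r subrr.
rewrite big_nat_recr//= mulrDr IHn -[in RHS]natr1 [in RHS]mulrDl mul1r cexpD.
by ring.
Qed.

Lemma cnorm1_cexp_sum y (n : nat) :
  cnorm1 (\sum_(1 <= k < n.+1) cexp (k%:R * y)) * (1 - cos (2 * pi * y)) <= 6.
Proof.
set S := \sum_(_ <= k < _) _; set z := cexp y - 1.
(* The conjugate of [z], so that the product is |z|^2 = 2 (1 - cos (2 pi y)). Multiplying the
   geometric sum identity by it bounds 2 (1 - cos (2 pi y)) times the norm of [S] by 3 * 4. *)
pose z' : R[i] := (cos (2 * pi * y) - 1) +i* - sin (2 * pi * y).
have zz : z' * z = (2 * (1 - cos (2 * pi * y)))%:C.
  apply/eqP; rewrite eq_complex /=; apply/andP; split; apply/eqP; last by ring.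
  by have := cos2Dsin2 (2 * pi * y); lra.
have c1 : 0 <= 1 - cos (2 * pi * y).
  by rewrite subr_ge0 cos_le1.
have := cnorm1Z (2 * (1 - cos (2 * pi * y))) S.
rewrite -zz -mulrA /S /z cexp_geometric.
have := cnorm1M z' (cexp (n.+1%:R * y) - cexp y).
have : cnorm1 (cexp (n.+1%:R * y) - cexp y) <= 4.
  apply: le_trans (cnorm1D _ _) _; rewrite cnorm1N.
  have := cnorm1_cexp y; have := cnorm1_cexp (n.+1%:R * y); lra.
have : cnorm1 z' <= 3.
  rewrite /cnorm1 /z' /= normrN; have := sin_max (2 * pi * y).
  have := ler_normB (cos (2 * pi * y)) 1; have := cos_max (2 * pi * y).
  by rewrite normr1; lra.
rewrite (ger0_norm (mulr_ge0 _ c1))// -/S.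
have := cnorm1_ge0 z'; have := cnorm1_ge0 (cexp (n.+1%:R * y) - cexp y).
nra.
Qed.

(** If q_j x = k and q_l x = k' were both integers, then k' q_j - k q_l = 0 as x is nonzero, so
    independence gives k = 0; then q_j = 0, which contradicts independence again. *)
Lemma cos_2pi_rat_indep (m : nat) (q : 'I_m -> R) x (j l : 'I_m) :
  rat_indep q -> x != 0 -> j != l ->
  cos (2 * pi * (q j * x)) = 1 -> cos (2 * pi * (q l * x)) != 1.
Proof.
move=> qi x0 jl /cos_2pi_eq1[k qk]; apply/eqP => /cos_2pi_eq1[k' qk'].
have lj : l != j by rewrite eq_sym.
have sumE (u v : rat) : let c i := if i == j then u else if i == l then v else 0 in
    \sum_(i < m) ratr (c i) * q i = ratr u * q j + ratr v * q l.
  rewrite /= (bigD1 j)//= eqxx (bigD1 l)//= (negbTE lj) eqxx big1 ?addr0//.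
  by move=> i /andP[/negbTE -> /negbTE ->]; rewrite raddf0 mul0r.
have H1 := qi (fun i => if i == j then k'%:~R else if i == l then - k%:~R else 0).
have {H1} /H1 /(_ l) : \sum_(i < m) ratr
    (if i == j then k'%:~R else if i == l then - k%:~R else 0) * q i = 0.
  rewrite sumE rmorphN /= !ratr_int; apply: (mulIf x0).
  by rewrite mulrDl -!mulrA qk qk'; ring.
rewrite (negbTE lj) eqxx => /eqP; rewrite oppr_eq0 intr_eq0 => /eqP k0.
have qj0 : q j = 0 by apply: (mulIf x0); rewrite qk k0 mul0r.
have H2 := qi (fun i => if i == j then 1 else if i == l then 0 else 0).
have {H2} /H2 /(_ j) : \sum_(i < m) ratr
    (if i == j then 1 else if i == l then 0 else 0) * q i = 0.
  by rewrite sumE qj0 mulr0 raddf0 mul0r addr0.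
by rewrite eqxx => /eqP; rewrite oner_eq0.
Qed.

(** For each pair the sum is continuous and, by rational independence, positive on the compact
    interval [delta, X]; its minimum is then positive, and there are finitely many pairs. Negative x
    follow by evenness. *)
Lemma one_sub_cos_pair_lower_bound (m : nat) (q : 'I_m -> R) delta X :
  rat_indep q -> 0 < delta ->
  exists2 eta : R, 0 < eta & forall x (j l : 'I_m), delta <= `|x| <= X ->
    j != l -> eta <= (1 - cos (2 * pi * (q j * x))) + (1 - cos (2 * pi * (q l * x))).
Proof.
move=> qi d0.
pose u (p : 'I_m * 'I_m) x := (1 - cos (2 * pi * (q p.1 * x))) + (1 - cos (2 * pi * (q p.2 * x))).
have [Xd|dX] := ltP X delta.
  by exists 1 => // x j l /andP[h1 h2]; lra.
have /choice[e He] (p : 'I_m * 'I_m) : exists e : R, 0 < e /\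
    (p.1 != p.2 -> forall x, delta <= x <= X -> e <= u p x).
  have [_|p12] := eqVneq p.1 p.2; first by exists 1.
  have cu : continuous (u p).
    by apply: is_derive_continuous => x; apply: is_derive_eq.
  have [c cdX cmin] := EVT_min dX (continuous_subspaceT cu).
  exists (u p c); split=> [|_ x xdX]; last exact: cmin.
  have c0 : c != 0 by move: cdX; rewrite in_itv /= => /andP[cd _]; rewrite gt_eqF//; lra.
  have c1 := cos_le1 (2 * pi * (q p.1 * c)); have c2 := cos_le1 (2 * pi * (q p.2 * c)).
  have := @cos_2pi_rat_indep m q c p.1 p.2 qi c0 p12.
  rewrite lt_neqAle; have -> : 0 <= u p c by rewrite /u; lra.
  rewrite andbT => H; apply/eqP => u0.
  have /H/eqP : cos (2 * pi * (q p.1 * c)) = 1 by rewrite /u in u0; lra.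
  by apply; rewrite /u in u0; lra.
exists (\big[Order.min/1]_p e p).
  by apply: lt_bigmin => // p _; have [] := He p.
move=> x j l /andP[dx xX] jl.
apply: (@le_trans _ _ (e (j, l))); first exact: bigmin_le_cond.
have [_ /(_ jl)] := He (j, l); rewrite /u /= => H.
have [x0|x0] := leP 0 x; first by apply: H; rewrite -(ger0_norm x0) dx.
have := H (- x); rewrite !mulrN !cosN; apply.
by rewrite -(ltr0_norm x0) dx.
Qed.

(** The sum over k with step q_j is bounded by 12 / eta for all j but at most one, and trivially by
    2 (n + 1) for that one. Both contributions are small against the number (m + 1) (n + 1) of
    frequencies. *)
Lemma propC_cexp_sum (Gamma : set R) delta X theta : propC Gamma ->
  0 < delta -> 0 < theta ->
  exists bs : seq R, [/\ bs != [::], (forall b, b \in bs -> Gamma b) &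
    forall x, delta <= `|x| <= X ->
      cnorm1 (\sum_(b <- bs) cexp (b * x)) <= theta * (size bs)%:R].
Proof.
move=> GC d0 t0.
(* The exceptional sum, at most 4 (n + 1) once the shift a_j costs a factor 2, is then at most half
   of theta (m + 1) (n + 1). *)
have [m m8] : exists m : nat, 8 / theta <= m.+1%:R.
  by exists (Num.truncn (8 / theta)); apply/ltW/truncnS_gt.
have [q [qi qa]] := GC m.+1.
have [eta e0 Heta] := @one_sub_cos_pair_lower_bound m.+1 q delta X qi d0.
(* Chosen after [eta], which depends on m and q: the m + 1 sums of size 2 * 12 / eta take at most
   the other half. *)
have [n n48] : exists n : nat, 48 / (eta * theta) <= n.+1%:R.
  by exists (Num.truncn (48 / (eta * theta))); apply/ltW/truncnS_gt.
have [a Ha] := qa n.+1.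
(* A list keeps multiplicities: coinciding frequencies are counted separately and the size is
   exactly (m + 1) (n + 1). *)
exists [seq a j + k%:R * q j | j <- enum 'I_m.+1, k <- index_iota 1 n.+2].
split.
- by rewrite -size_eq0 size_allpairs size_enum_ord size_iota.
- move=> _ /allpairsP[[j k] /= [_ + ->]]; rewrite mem_index_iota => kn.
  exact: Ha.
move=> x dxX.
rewrite size_allpairs size_enum_ord size_iota big_allpairs_dep big_enum /=.
rewrite subn1 /= natrM.
pose S j := \sum_(1 <= k < n.+2) cexp (k%:R * (q j * x)).
pose c j := 1 - cos (2 * pi * (q j * x)).
have c0 j : 0 <= c j by rewrite subr_ge0 cos_le1.
have S1 j : cnorm1 (S j) <= 2 * n.+1%:R.
  apply: (le_trans (cnorm1_sum _ _ _)).
  apply: (@le_trans _ _ (\sum_(1 <= k < n.+2) 2)).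
    by apply: ler_sum => k _; apply: cnorm1_cexp.
  by rewrite sumr_const_nat subn1 mulr_natr.
have S2 j : eta <= 2 * c j -> cnorm1 (S j) <= 12 / eta.
  move=> ej; rewrite ler_pdivlMr//.
  have := cnorm1_cexp_sum (q j * x) n.+1; rewrite -/(S j) -/(c j).
  have := cnorm1_ge0 (S j); nra.
have Sall : \sum_(j < m.+1) cnorm1 (S j) <= 2 * n.+1%:R + m.+1%:R * (12 / eta).
  have e12 : 0 <= 12 / eta by rewrite divr_ge0// ltW.
  have cst : \sum_(j < m.+1) 12 / eta = m.+1%:R * (12 / eta).
    by rewrite sumr_const card_ord [RHS]mulr_natl.
  (* Since c_j + c_l >= eta for j != l, at most one index [j0] can satisfy 2 c_j0 < eta. *)
  have [/existsP[j0 j0c]|] := boolP [exists j, 2 * c j < eta]; last first.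
    rewrite negb_exists => /forallP h; apply: (@le_trans _ _ (m.+1%:R * (12 / eta))).
      rewrite -cst; apply: ler_sum => j _; apply: S2; by rewrite leNgt h.
    by rewrite lerDr mulr_ge0.
  rewrite (bigD1 j0)//= lerD// -cst [leRHS](bigD1 j0)//=.
  apply: (@le_trans _ _ (\sum_(i < m.+1 | i != j0) 12 / eta)); last by rewrite lerDr.
  apply: ler_sum => j jj0; apply: S2.
  have := Heta x j j0 dxX jj0; rewrite -/(c j) -/(c j0); lra.
apply: (@le_trans _ _ (\sum_(j < m.+1) 2 * cnorm1 (S j))).
  apply: (le_trans (cnorm1_sum _ _ _)); apply: ler_sum => j _.
  rewrite (_ : \sum_(_ <- _) _ = cexp (a j * x) * S j); last first.
    rewrite /S mulr_sumr; apply: eq_bigr => k _.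
    by rewrite mulrDl cexpD mulrA.
  apply: (le_trans (cnorm1M _ _)).
  by rewrite ler_wpM2r ?cnorm1_ge0 ?cnorm1_cexp.
rewrite -mulr_sumr.
have m0 : 0 < m.+1%:R :> R by rewrite ltr0n.
have n0 : 0 < n.+1%:R :> R by rewrite ltr0n.
move: m8 n48; rewrite ler_pdivrMr// ler_pdivrMr ?mulr_gt0// => m8 n48.
have : 12 / eta * (2 * m.+1%:R) <= theta / 2 * m.+1%:R * n.+1%:R.
  rewrite mulrAC ler_pdivrMr//; nra.
have : 4 * n.+1%:R <= theta / 2 * m.+1%:R * n.+1%:R by nra.
lra.
Qed.

End ExponentialSums.

(** * The interpolation kernel *)

Lemma integrable_Rintegral_sum (d : measure_display) (T : measurableType d)
    (R : realType) (mu : {measure set T -> \bar R}) (D : set T) (I : Type)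
    (r : seq I) (F : I -> T -> R) : measurable D ->
  (forall i, mu.-integrable D (EFin \o F i)) ->
  mu.-integrable D (EFin \o (fun t => \sum_(i <- r) F i t)) /\
  Rintegral mu D (fun t => \sum_(i <- r) F i t) =
    \sum_(i <- r) Rintegral mu D (F i).
Proof.
move=> mD iF; elim: r => [|i r [IH1 IH2]].
  under eq_fun do rewrite big_nil.
  by rewrite big_nil Rintegral_cst// mul0r; split => //; apply: integrable0.
under eq_fun do rewrite big_cons.
rewrite RintegralD// IH2 big_cons; split => //.
exact: (integrableD mD (iF i) IH1).
Qed.

Section Kernel.
Variable R : realType.
Implicit Types (a b t x y delta M : R) (bs : seq R).

Local Notation mu := (@lebesgue_measure R).

Lemma integrable_bounded_support (f : R -> R) a b M :
  measurable_fun setT f ->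
  (forall t, `[a, b]%classic t -> `|f t| <= M) ->
  (forall t, ~ `[a, b]%classic t -> f t = 0) ->
  mu.-integrable setT (EFin \o f).
Proof.
move=> mf fM f0.
have -> : EFin \o f = (EFin \o f) \_ `[a, b].
  apply/funext => t /=; rewrite patchE; case: ifPn => // /negP tab.
  by rewrite /= f0// => H; apply: tab; rewrite inE.
apply/(integrable_mkcond _ _).1 => //.
apply: measurable_bounded_integrable => //.
- by rewrite /= lebesgue_measure_itv/=; case: ifP => // _; rewrite -EFinB ltry.
- exact: measurable_funTS.
- exists M; split; first exact: num_real.
  by move=> u Mu t tab; apply/ltW/(le_lt_trans (fM _ tab)).
Qed.

Lemma Rintegral_bounded_support_le (f : R -> R) a b M :
  measurable_fun setT f ->
  (forall t, `[a, b]%classic t -> `|f t| <= M) ->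
  (forall t, ~ `[a, b]%classic t -> f t = 0) ->
  `|Rintegral mu setT f| <= M * fine (mu `[a, b]).
Proof.
move=> mf fM f0.
have fi := integrable_bounded_support mf fM f0.
have fiab : mu.-integrable `[a, b] (EFin \o f).
  exact: integrableS fi.
have -> : Rintegral mu setT f = Rintegral mu `[a, b] f.
  rewrite [RHS]Rintegral_mkcond; apply: eq_Rintegral => t _.
  rewrite patchE; case: ifPn => // /negP tab.
  by rewrite /= f0// => H; apply: tab; rewrite inE.
apply: (le_trans (le_normr_Rintegral _ fiab)) => //.
rewrite -Rintegral_cst//; apply: le_Rintegral => //.
- exact: (integrable_norm fiab).
- apply: measurable_bounded_integrable => //.
  + by rewrite /= lebesgue_measure_itv/=; case: ifP => // _; rewrite -EFinB ltry.
  + exists `|M|; split; first exact: num_real.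
    by move=> u Mu t tab; apply/ltW.
Qed.

Lemma measurable_bump b : measurable_fun setT (bump b).
Proof.
apply: (@measurable_funM _ _ _ _ (fun t => (t - b) * (b + 1 - t))).
  have c : continuous (fun t : R => (t - b) * (b + 1 - t)).
    by apply: is_derive_continuous => x; apply: is_derive_eq.
  exact: continuous_measurable_fun.
exact: measurable_indic.
Qed.

Lemma bump_out b t : ~ (b <= t <= b + 1) -> bump b t = 0.
Proof.
by move=> bt; rewrite /bump indicE memNset ?mulr0.
Qed.

Lemma bump_le1 b t : `|bump b t| <= 1.
Proof.
have [bt|/negP/bump_out ->] := boolP (b <= t <= b + 1); last by rewrite normr0.
rewrite /bump indicE mem_set ?mulr1 /=; last by rewrite in_itv.
case/andP: bt => b1 b2; rewrite ger0_norm; first nra.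
by rewrite mulr_ge0//; lra.
Qed.

Lemma measurable_cos_freq y : measurable_fun setT (fun t => cos (2 * pi * t * y)).
Proof.
have c : continuous (fun t : R => cos (2 * pi * t * y)).
  by apply: is_derive_continuous => x; apply: is_derive_eq.
exact: continuous_measurable_fun.
Qed.

Lemma measurable_sin_freq y : measurable_fun setT (fun t => sin (2 * pi * t * y)).
Proof.
have c : continuous (fun t : R => sin (2 * pi * t * y)).
  by apply: is_derive_continuous => x; apply: is_derive_eq.
exact: continuous_measurable_fun.
Qed.

(** The bump has integral 1/6, so the factor 6 and the averaging normalise the transform to 1 at the
    origin. *)
Definition kernel bs t : R := 6 / (size bs)%:R * \sum_(b <- bs) bump b t.

Definition kernelFT bs y : R[i] :=
  (6 / (size bs)%:R)%:C * (\sum_(b <- bs) cexp (b * y) * bumpFT y).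

Lemma measurable_kernel bs : measurable_fun setT (kernel bs).
Proof.
apply: measurable_funM; first exact: measurable_cst.
by apply: measurable_sum => b; apply: measurable_bump.
Qed.

Lemma kernel_bounded bs t : bs != [::] -> `|kernel bs t| <= 6.
Proof.
move=> bs0; rewrite normrM ger0_norm ?divr_ge0// mulrAC.
have s0 : 0 < (size bs)%:R :> R by rewrite ltr0n lt0n size_eq0.
rewrite ler_pdivrMr// ler_pM2l//.
apply: (le_trans (ler_norm_sum _ _ _)).
apply: (@le_trans _ _ (\sum_(b <- bs) 1)); first by apply: ler_sum => b _; exact: bump_le1.
by rewrite big_const_seq count_predT iter_addr_0.
Qed.

Lemma kernel_out bs t : (forall b, b \in bs -> ~ (b <= t <= b + 1)) -> kernel bs t = 0.
Proof.
move=> H; rewrite /kernel big_seq big1 ?mulr0// => b /H; exact: bump_out.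
Qed.

Lemma kernel_support bs : exists B : R, forall t, ~ `[- B, B]%classic t -> kernel bs t = 0.
Proof.
exists (1 + \sum_(b <- bs) `|b|) => t tB; apply: kernel_out => b bbs /andP[bt tb].
apply: tB => /=; rewrite in_itv /=.
have : `|b| <= \sum_(b <- bs) `|b|.
  by rewrite (big_rem b)//= lerDl sumr_ge0.
by rewrite ler_norml => /andP[? ?]; apply/andP; split; lra.
Qed.

Lemma integrable_bump_mul b (f : R -> R) : measurable_fun setT f ->
  (forall t, `|f t| <= 1) -> mu.-integrable setT (EFin \o (fun t => bump b t * f t)).
Proof.
move=> mf f1; apply: (@integrable_bounded_support _ b (b + 1) 1).
- by apply: measurable_funM => //; apply: measurable_bump.
- by move=> t _; rewrite normrM mulr_ile1// bump_le1.
- by move=> t /=; rewrite in_itv /= => /bump_out ->; rewrite mul0r.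
Qed.

Lemma Rintegral_kernel_mul bs (f : R -> R) : measurable_fun setT f ->
  (forall t, `|f t| <= 1) ->
  Rintegral mu setT (fun t => kernel bs t * f t) =
  6 / (size bs)%:R * \sum_(b <- bs) Rintegral mu setT (fun t => bump b t * f t).
Proof.
move=> mf f1.
have ib b := @integrable_bump_mul b f mf f1.
have [H1 H2] := integrable_Rintegral_sum bs measurableT ib.
rewrite -H2 -RintegralZl//; apply: eq_Rintegral => t _.
by rewrite -mulrA mulr_suml.
Qed.

Lemma Re_sum (I : Type) (r : seq I) (F : I -> R[i]) :
  Re (\sum_(i <- r) F i) = \sum_(i <- r) Re (F i).
Proof.
elim: r => [|i r IHr]; first by rewrite !big_nil.
by rewrite !big_cons -IHr; case: (F i) (\sum_(_ <- r) _) => [? ?] [].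
Qed.

Lemma Im_sum (I : Type) (r : seq I) (F : I -> R[i]) :
  Im (\sum_(i <- r) F i) = \sum_(i <- r) Im (F i).
Proof.
elim: r => [|i r IHr]; first by rewrite !big_nil.
by rewrite !big_cons -IHr; case: (F i) (\sum_(_ <- r) _) => [? ?] [].
Qed.

Lemma Rintegral_kernel bs y :
  Rintegral mu setT (fun t => kernel bs t * cos (2 * pi * t * y)) = Re (kernelFT bs y) /\
  Rintegral mu setT (fun t => kernel bs t * sin (2 * pi * t * y)) = Im (kernelFT bs y).
Proof.
rewrite (Rintegral_kernel_mul bs (measurable_cos_freq y) (fun t => cos_max _)).
rewrite (Rintegral_kernel_mul bs (measurable_sin_freq y) (fun t => sin_max _)).
have ReZ (c : R) z : Re (c%:C * z) = c * Re z by case: z => u v; rewrite /= mul0r subr0.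
have ImZ (c : R) z : Im (c%:C * z) = c * Im z by case: z => u v; rewrite /= mul0r addr0.
rewrite /kernelFT ReZ ImZ Re_sum Im_sum; split; congr (_ * _); apply: eq_bigr => b _;
  by have [] := Rintegral_bump b y.
Qed.

Lemma kernelFT0 bs : bs != [::] -> kernelFT bs 0 = 1.
Proof.
move=> bs0; rewrite /kernelFT bumpFT0.
under eq_bigr do rewrite mulr0 cexp0 mul1r.
have s0 : (size bs)%:R != 0 :> R by rewrite pnatr_eq0 size_eq0.
rewrite big_const_seq count_predT iter_addr_0.
rewrite -[X in _ * X]mulr_natr -(rmorph_nat (real_complex R)) -!rmorphM /=.
by rewrite (_ : _ * _ = 1)//; field.
Qed.

Lemma propC_kernel (Gamma : set R) delta : propC Gamma -> 0 < delta ->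
  exists bs : seq R, [/\ bs != [::], (forall b, b \in bs -> Gamma b) &
    forall s : seq R, uniq s ->
      (forall x y, x \in s -> y \in s -> x != y -> delta <= `|x - y|) ->
      (forall y, y \in s -> delta <= `|y|) ->
      \sum_(y <- s) cnorm1 (kernelFT bs y) <= 2^-1].
Proof.
(* [X] settles the far points, where exponentials are bounded by 2: 12 * 4 / (delta X) <= 1/4 as
   delta X >= 192. [theta] settles the near ones: 6 theta * 4 / delta^2 = 1/4. *)
move=> GC d0; pose X := delta + 192 / delta; pose theta := delta ^+ 2 / 96.
have t0 : 0 < theta by rewrite divr_gt0// exprn_gt0.
have dX : delta <= X by rewrite lerDl divr_ge0// ltW.
have [bs [bs0 bsG Hbs]] := propC_cexp_sum X GC d0 t0.
exists bs; split => // s us sep sd.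
have s0 : 0 < (size bs)%:R :> R by rewrite ltr0n lt0n size_eq0.
have ker_le y v : y != 0 -> cnorm1 (\sum_(b <- bs) cexp (b * y)) <= v * (size bs)%:R ->
    cnorm1 (kernelFT bs y) <= 6 * v * y ^- 2.
  move=> y0 H; rewrite /kernelFT cnorm1Z -mulr_suml ger0_norm ?divr_ge0//.
  rewrite -!mulrA ler_pM2l// ler_pdivrMl// mulrA [(size bs)%:R * v]mulrC.
  apply: (le_trans (cnorm1M _ _)).
  by apply: ler_pM; rewrite ?cnorm1_ge0 ?cnorm1_bumpFT.
have y0 y : y \in s -> y != 0 by move/sd => dy; rewrite -normr_gt0; lra.
rewrite big_seq (bigID (fun y => X <= `|y|)) /= (_ : 2^-1 = 4^-1 + 4^-1); last by lra.
apply: lerD.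
  apply: (@le_trans _ _ (\sum_(y <- s | X <= `|y|) 12 * y ^- 2)).
    rewrite big_seq_cond [leRHS]big_seq_cond.
    rewrite (eq_bigl (fun y => (y \in s) && (X <= `|y|))); last first.
      by move=> y /=; rewrite andbA andbb.
    apply: ler_sum => y /andP[ys _].
    rewrite (_ : 12 = 6 * 2); last by ring.
    apply: ker_le; first exact: y0.
    apply: (le_trans (cnorm1_sum _ _ _)).
    apply: (@le_trans _ _ (\sum_(b <- bs) 2)); first by apply: ler_sum => b _; exact: cnorm1_cexp.
    by rewrite big_const_seq count_predT iter_addr_0 mulr_natr.
  rewrite -mulr_sumr.
  have := sum_inv_sqr_separated d0 dX us sep.
  have X0 : 0 < X by lra.
  have : 4 / (delta * X) <= 48^-1.
    rewrite ler_pdivrMr ?mulr_gt0// /X mulrDr [_ * (_ / _)]mulrC divfK ?gt_eqF//; nra.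
  lra.
(* Nonnegative terms are added, so that the bound for separated sets applies to all |y| >= delta,
   with delta in the role of X. *)
apply: (@le_trans _ _ (\sum_(y <- s | delta <= `|y|) 6 * theta * y ^- 2)).
  rewrite big_seq_cond [leRHS]big_seq_cond.
  rewrite [leRHS](bigID (fun y => X <= `|y|)) /=.
  rewrite -[leLHS]add0r lerD//.
    apply: sumr_ge0 => y _.
    by rewrite mulr_ge0 ?invr_ge0 ?sqr_ge0// mulr_ge0// ltW.
  rewrite (eq_bigl (fun y => ((y \in s) && (delta <= `|y|)) && ~~ (X <= `|y|))); last first.
    by move=> y /=; have [/sd ->|//] := boolP (y \in s); rewrite ?andbT ?andbF.
  apply: ler_sum => y /andP[/andP[ys dy] yX].
  apply: ker_le; first exact: y0.
  by apply: Hbs; rewrite dy /= ltW// ltNge.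
rewrite -mulr_sumr.
have := sum_inv_sqr_separated d0 (lexx delta) us sep.
set T := \sum_(_ <- _ | _) _ => HT.
apply: (@le_trans _ _ (6 * theta * (4 / (delta * delta)))).
  by rewrite ler_pM2l// mulr_gt0.
rewrite /theta le_eqVlt; apply/orP; left; apply/eqP; field; by rewrite gt_eqF.
Qed.

End Kernel.

(** * Successive approximation in l^1 *)

Section Interpolation.
Variables (R : realType) (g : R -> R[i]) (L : set R) (delta : R).
Implicit Types (x t rho : R) (s : seq R) (p : seq (R[i] * R)).

Hypothesis g0 : g 0 = 1.
Hypothesis sepL : forall x y, L x -> L y -> x != y -> delta <= `|x - y|.
Hypothesis g_sum : forall s, uniq s ->
  (forall x y, x \in s -> y \in s -> x != y -> delta <= `|x - y|) ->
  (forall y, y \in s -> delta <= `|y|) -> \sum_(y <- s) cnorm1 (g y) <= 2^-1.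

(* A list of pairs (c, mu) stands for the combination of translates
   [\sum c * g (x - mu)], which is the inverse Fourier transform of [G * exppoly p]
   when g is that of G. *)
Definition translates p x : R[i] := \sum_(u <- p) u.1 * g (x - u.2).

Definition exppoly p t : R[i] := \sum_(u <- p) u.1 * cexp (- (t * u.2)).

(** Finite sums over distinct points stand for the l^1 norm over L, which makes sense for an
    arbitrary set L. *)
Definition l1_le (r : R -> R[i]) rho := forall s, uniq s -> (forall x, x \in s -> L x) ->
  \sum_(x <- s) cnorm1 (r x) <= rho.

Lemma g_sum_translate s x : L x -> uniq s -> (forall y, y \in s -> L y) ->
  \sum_(y <- s | y != x) cnorm1 (g (y - x)) <= 2^-1.
Proof.
move=> Lx us sL; rewrite -big_filter; set s' := seq.filter _ _.
have s's y : y \in s' -> L y /\ y != x by rewrite mem_filter => /andP[-> /sL].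
rewrite -(big_map (fun y => y - x) xpredT (fun y => cnorm1 (g y))).
apply: g_sum.
- by rewrite map_inj_uniq ?filter_uniq//; apply: addIr.
- move=> _ _ /mapP[a /s's[La _] ->] /mapP[b /s's[Lb _] ->].
  rewrite (inj_eq (addIr _)) => /(sepL La Lb).
  by rewrite (_ : a - x - (b - x) = a - b)//; ring.
- by move=> _ /mapP[a /s's[La ax] ->]; apply: sepL.
Qed.

(** Choose a finite [s] carrying the l^1 norm of r up to rho / 4, and subtract r(y) g(. - y) for
    each y in it. As g 0 = 1, the residual on [s] cancels up to cross terms; all cross terms
    together add at most rho / 2, and 1/4 + 1/2 = 3/4. *)
Lemma l1_step (r : R -> R[i]) rho : 0 < rho -> l1_le r rho ->
  exists p, \sum_(u <- p) cnorm1 u.1 <= rho /\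
    l1_le (fun x => r x - translates p x) (3 / 4 * rho).
Proof.
move=> rho0 rle.
pose A := [set \sum_(x <- s) cnorm1 (r x) | s in
             [set s : seq R | uniq s /\ forall x, x \in s -> L x]].
have supA : has_sup A.
  split; first by exists 0, [::] => //; rewrite big_nil.
  by exists rho => _ [s [us sL] <-]; apply: rle.
have e0 : 0 < rho / 4 by lra.
have [_ [s [us sL] <-] sA] := sup_adherent e0 supA.
(* Appending to [s] points outside it cannot exceed [sup A], so those points carry at most rho /
   4. *)
have tail s' : uniq s' -> (forall x, x \in s' -> L x) ->
    \sum_(x <- s' | x \notin s) cnorm1 (r x) <= rho / 4.
  move=> us' s'L; rewrite -big_filter; set s2 := seq.filter _ _.
  have : \sum_(x <- s ++ s2) cnorm1 (r x) <= sup A.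
    apply: sup_upper_bound => //; exists (s ++ s2) => //; split.
      rewrite cat_uniq us filter_uniq//= andbT -all_predC.
      by apply/allP => x; rewrite mem_filter => /andP[].
    by move=> x; rewrite mem_cat mem_filter => /orP[/sL//|/andP[_ /s'L]].
  by rewrite big_cat /=; lra.
exists [seq (r x, x) | x <- s]; split; first by rewrite big_map; apply: rle.
move=> s' us' s'L.
apply: (@le_trans _ _ (\sum_(x <- s') ((if x \notin s then cnorm1 (r x) else 0) +
   \sum_(y <- s | y != x) cnorm1 (r y) * cnorm1 (g (x - y))))).
  apply: ler_sum => x _; rewrite /translates big_map /=.
  have sumle : cnorm1 (\sum_(y <- s | y != x) r y * g (x - y)) <=
      \sum_(y <- s | y != x) cnorm1 (r y) * cnorm1 (g (x - y)).
    apply: (le_trans (cnorm1_sum _ _ _)); apply: ler_sum => y _; exact: cnorm1M.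
  case: ifPn => [xs|/negbNE xs].
    apply: (le_trans (cnorm1D _ _)); rewrite lerD2l cnorm1N.
    rewrite big_seq_cond (eq_bigl (fun y => (y \in s) && (y != x))) -?big_seq_cond//.
    by move=> y /=; rewrite andbT; case ys : (y \in s) => //=; apply/esym; apply: contraNneq xs => <-.
  rewrite (big_rem x)//= subrr g0 mulr1 opprD addrA subrr sub0r cnorm1N add0r.
  by rewrite (rem_filter _ us) big_filter.
rewrite big_split /= -big_mkcond /=.
apply: (@le_trans _ _ (rho / 4 + rho * 2^-1)); last by lra.
apply: lerD; first exact: tail.
(* With the centre y outermost, the inner sum runs over one translate of g without its central
   value, hence is at most 1/2. *)
rewrite (exchange_big_dep xpredT) //=.
apply: (@le_trans _ _ (\sum_(y <- s) cnorm1 (r y) * 2^-1)).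
  rewrite big_seq [leRHS]big_seq; apply: ler_sum => y ys.
  rewrite -mulr_sumr ler_wpM2l ?cnorm1_ge0//.
  under eq_bigl do rewrite eq_sym.
  by apply: g_sum_translate => //; apply: sL.
by rewrite -mulr_suml ler_wpM2r//; apply: rle.
Qed.

Lemma l1_iteration (r : R -> R[i]) : l1_le r 1 ->
  exists Q : nat -> seq (R[i] * R),
    [/\ Q 0%N = [::],
        forall n x, L x -> cnorm1 (r x - translates (Q n) x) <= (3 / 4) ^+ n &
        forall n t, cnorm1 (exppoly (Q n.+1) t - exppoly (Q n) t) <= 2 * (3 / 4) ^+ n].
Proof.
move=> r1.
(* The hypotheses on the state (combination, bound) are put under the existential, so that choice
   yields a total function; its default, where they fail, is the empty list. *)
have /choice[next nextP] (v : seq (R[i] * R) * R) : exists p, 0 < v.2 ->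
    l1_le (fun x => r x - translates v.1 x) v.2 ->
    \sum_(u <- p) cnorm1 u.1 <= v.2 /\
    l1_le (fun x => r x - translates (v.1 ++ p) x) (3 / 4 * v.2).
  have [[v0 rv]|H] := pselect (0 < v.2 /\ l1_le (fun x => r x - translates v.1 x) v.2).
    have [p [p1 p2]] := l1_step v0 rv; exists p => _ _; split => //.
    move=> s us sL; apply: le_trans (p2 s us sL).
    by apply: ler_sum => x _; rewrite /translates big_cat /= opprD addrA.
  by exists [::] => v0 rv; exfalso; apply: H.
pose Q := fix Q n := if n is n'.+1 then Q n' ++ next (Q n', (3 / 4) ^+ n') else [::].
have c0 n : 0 < (3 / 4 : R) ^+ n by rewrite exprn_gt0//; lra.
have QP n : l1_le (fun x => r x - translates (Q n) x) ((3 / 4) ^+ n).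
  elim: n => [|n IHn] /=.
    move=> s us sL; rewrite expr0; apply: le_trans (r1 s us sL).
    by apply: ler_sum => x _; rewrite /translates big_nil subr0.
  by have [_] := nextP (Q n, (3 / 4) ^+ n) (c0 n) IHn; rewrite exprS.
exists Q; split => // [n x Lx|n t].
  have := QP n [:: x] isT; rewrite big_seq1; apply => y.
  by rewrite inE => /eqP ->.
have [+ _] := nextP (Q n, (3 / 4) ^+ n) (c0 n) (QP n) => /= H.
rewrite /exppoly big_cat /= addrAC subrr add0r.
apply: (le_trans (cnorm1_sum _ _ _)).
apply: (@le_trans _ _ (\sum_(u <- next (Q n, (3 / 4) ^+ n)) 2 * cnorm1 u.1)).
  apply: ler_sum => u _; apply: (le_trans (cnorm1M _ _)).
  by rewrite mulrC ler_wpM2r ?cnorm1_ge0 ?cnorm1_cexp.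
by rewrite -mulr_sumr ler_pM2l.
Qed.

End Interpolation.

(** The intervals of centre u_n and radius 8 (3/4)^n are nested, because 2 + 8 * 3/4 = 8; the
    supremum of their left ends lies in all of them, which gives the limit together with its
    rate. *)
Lemma geometric_increments_cvg (R : realType) (u : nat -> R) :
  (forall n, `|u n.+1 - u n| <= 2 * (3 / 4) ^+ n) ->
  exists l : R, forall n, `|l - u n| <= 8 * (3 / 4) ^+ n.
Proof.
pose c : R := 3 / 4; rewrite -/c => du.
have c0 n : 0 <= c ^+ n by rewrite exprn_ge0// /c; lra.
have cS n : c ^+ n.+1 = 3 / 4 * c ^+ n by rewrite exprS.
have incr n m : u n - 8 * c ^+ n <= u (n + m)%N - 8 * c ^+ (n + m).
  elim: m => [|m IHm]; first by rewrite addn0.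
  apply: (le_trans IHm); rewrite addnS cS.
  have := du (n + m)%N; rewrite ler_norml => /andP[+ _].
  by have := c0 (n + m)%N; lra.
have decr n m : u (n + m)%N + 8 * c ^+ (n + m) <= u n + 8 * c ^+ n.
  elim: m => [|m IHm]; first by rewrite addn0.
  apply: le_trans IHm; rewrite addnS cS.
  have := du (n + m)%N; rewrite ler_norml => /andP[_ +].
  by have := c0 (n + m)%N; lra.
have cross n m : u n - 8 * c ^+ n <= u m + 8 * c ^+ m.
  have := incr n m; have := decr m n; rewrite [(m + n)%N]addnC.
  by have := c0 (n + m)%N; lra.
pose A := range (fun n => u n - 8 * c ^+ n).
have supA : has_sup A.
  split; first by exists (u 0%N - 8 * c ^+ 0), 0%N.
  by exists (u 0%N + 8 * c ^+ 0) => _ [n _ <-].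
exists (sup A) => n; rewrite ler_distl; apply/andP; split.
  by apply: sup_upper_bound => //; exists n.
apply: ge_sup => [|_ [m _ <-] //]; by case: supA.
Qed.

(** * Failure of uniqueness *)

Section NonUniqueness.
Variable R : realType.
Implicit Types (a b t x y delta : R) (bs : seq R) (p : seq (R[i] * R)).

Local Notation mu := (@lebesgue_measure R).

Lemma geometric_small (C e : R) : 0 < e -> \forall n \near \oo, C * (3 / 4) ^+ n <= e.
Proof.
move=> e0.
have c : (fun n : nat => C * (3 / 4) ^+ n) @ \oo --> (0 : R).
  rewrite -[X in _ --> X](mulr0 C); apply: cvgM; first exact: cvg_cst.
  by apply: cvg_expr; rewrite ger0_norm; lra.
by apply: (cvgr_le _ c).
Qed.

Lemma eq_geometric_close (C a b : R) : (forall n : nat, `|a - b| <= C * (3 / 4) ^+ n) -> a = b.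
Proof.
move=> H; apply/eqP; rewrite -subr_eq0 -normr_le0; apply/ler_addgt0Pr => e e0.
have [N _ HN] := geometric_small C e0.
by rewrite add0r; apply: (le_trans (H N)); apply: HN => /=.
Qed.

Lemma exppoly_cexp p t x :
  Re (exppoly p t * cexp (t * x)) = \sum_(u <- p)
    (Re u.1 * cos (2 * pi * t * (x - u.2)) - Im u.1 * sin (2 * pi * t * (x - u.2))) /\
  Im (exppoly p t * cexp (t * x)) = \sum_(u <- p)
    (Re u.1 * sin (2 * pi * t * (x - u.2)) + Im u.1 * cos (2 * pi * t * (x - u.2))).
Proof.
have E u : u.1 * cexp (- (t * u.2)) * cexp (t * x) =
    u.1 * (cos (2 * pi * t * (x - u.2)) +i* sin (2 * pi * t * (x - u.2))).
  rewrite -mulrA -cexpD /cexp.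
  by rewrite (_ : 2 * pi * (- _ + _) = 2 * pi * t * (x - u.2))//; ring.
rewrite /exppoly mulr_suml Re_sum Im_sum.
by split; apply: eq_bigr => u _; rewrite E; case: u => [[]].
Qed.

Lemma measurable_exppoly_cexp p x :
  measurable_fun setT (fun t => Re (exppoly p t * cexp (t * x))) /\
  measurable_fun setT (fun t => Im (exppoly p t * cexp (t * x))).
Proof.
have -> : (fun t => Re (exppoly p t * cexp (t * x))) = fun t => \sum_(u <- p)
    (Re u.1 * cos (2 * pi * t * (x - u.2)) - Im u.1 * sin (2 * pi * t * (x - u.2))).
  by apply/funext => t; have [] := exppoly_cexp p t x.
have -> : (fun t => Im (exppoly p t * cexp (t * x))) = fun t => \sum_(u <- p)
    (Re u.1 * sin (2 * pi * t * (x - u.2)) + Im u.1 * cos (2 * pi * t * (x - u.2))).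
  by apply/funext => t; have [] := exppoly_cexp p t x.
have mc y := measurable_cos_freq y; have ms y := measurable_sin_freq y.
by split; apply: measurable_sum => u; [apply: measurable_funB|apply: measurable_funD];
  apply: measurable_funM => //; exact: measurable_cst.
Qed.

(** Multiplying the spectrum by a character translates the transform; the rest is linearity. *)
Lemma Rintegral_kernel_exppoly bs p x : bs != [::] ->
  [/\ mu.-integrable setT (EFin \o (fun t => kernel bs t * Re (exppoly p t * cexp (t * x)))),
      mu.-integrable setT (EFin \o (fun t => kernel bs t * Im (exppoly p t * cexp (t * x)))),
      Rintegral mu setT (fun t => kernel bs t * Re (exppoly p t * cexp (t * x)))
        = Re (translates (kernelFT bs) p x) &
      Rintegral mu setT (fun t => kernel bs t * Im (exppoly p t * cexp (t * x)))
        = Im (translates (kernelFT bs) p x)].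
Proof.
move=> bs0; have [B HB] := kernel_support bs.
have ik (f : R -> R) : measurable_fun setT f -> (forall t, `|f t| <= 1) ->
    mu.-integrable setT (EFin \o (fun t => kernel bs t * f t)).
  move=> mf f1; apply: (@integrable_bounded_support _ _ (- B) B 6).
  - by apply: measurable_funM => //; apply: measurable_kernel.
  - move=> t _; rewrite normrM -[leRHS]mulr1; apply: ler_pM => //.
    exact: kernel_bounded.
  - by move=> t /HB ->; rewrite mul0r.
have ic y := ik _ (measurable_cos_freq y) (fun t => cos_max _).
have is_ y := ik _ (measurable_sin_freq y) (fun t => sin_max _).
have iM (c : R) (f : R -> R) : mu.-integrable setT (EFin \o f) ->
    mu.-integrable setT (EFin \o (fun t => c * f t)).
  by move=> /(integrableZl measurableT c).
pose C y t := kernel bs t * cos (2 * pi * t * y).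
pose S y t := kernel bs t * sin (2 * pi * t * y).
have iR (u : R[i] * R) := integrableB measurableT (iM (Re u.1) _ (ic (x - u.2)))
  (iM (Im u.1) _ (is_ (x - u.2))).
have iI (u : R[i] * R) := integrableD measurableT (iM (Re u.1) _ (is_ (x - u.2)))
  (iM (Im u.1) _ (ic (x - u.2))).
have [IR ER] := @integrable_Rintegral_sum _ _ _ mu setT _ p
  (fun u t => Re u.1 * C (x - u.2) t - Im u.1 * S (x - u.2) t) measurableT iR.
have [II EI] := @integrable_Rintegral_sum _ _ _ mu setT _ p
  (fun u t => Re u.1 * S (x - u.2) t + Im u.1 * C (x - u.2) t) measurableT iI.
have fR : (fun t => kernel bs t * Re (exppoly p t * cexp (t * x))) =
    fun t => \sum_(u <- p) (Re u.1 * C (x - u.2) t - Im u.1 * S (x - u.2) t).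
  apply/funext => t; rewrite (exppoly_cexp p t x).1 mulr_sumr.
  by apply: eq_bigr => u _; rewrite /C /S; ring.
have fI : (fun t => kernel bs t * Im (exppoly p t * cexp (t * x))) =
    fun t => \sum_(u <- p) (Re u.1 * S (x - u.2) t + Im u.1 * C (x - u.2) t).
  apply/funext => t; rewrite (exppoly_cexp p t x).2 mulr_sumr.
  by apply: eq_bigr => u _; rewrite /C /S; ring.
have eC (c : R) y : Rintegral mu setT (fun t => c * C y t) = c * Re (kernelFT bs y).
  by rewrite RintegralZl ?(Rintegral_kernel bs y).1//; exact: ic.
have eS (c : R) y : Rintegral mu setT (fun t => c * S y t) = c * Im (kernelFT bs y).
  by rewrite RintegralZl ?(Rintegral_kernel bs y).2//; exact: is_.
rewrite fR fI ER EI /translates Re_sum Im_sum; split => //; apply: eq_bigr => u _.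
- rewrite (RintegralB measurableT (iM _ _ (ic _)) (iM _ _ (is_ _))) eC eS.
  by case: u => [[c d] m] /=; case: (kernelFT _ _).
- rewrite (RintegralD measurableT (iM _ _ (is_ _)) (iM _ _ (ic _))) eC eS.
  by case: u => [[c d] m] /=; case: (kernelFT _ _).
Qed.

(** On [- B, B] the weight is at most 1 + B^(2 alpha), so boundedness and compact support
    suffice. *)
Lemma powR_bounded_integrable_lty (alpha B M : R) (Fr Fi : R -> R) : 0 <= alpha ->
  measurable_fun setT Fr -> measurable_fun setT Fi ->
  (forall t, `|Fr t| <= M) -> (forall t, `|Fi t| <= M) ->
  (forall t, ~ `[- B, B]%classic t -> Fr t = 0 /\ Fi t = 0) ->
  (\int[lebesgue_measure]_t
     ((1 + `|t| `^ (2 * alpha)) * (Fr t ^+ 2 + Fi t ^+ 2))%:E < +oo)%E.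
Proof.
move=> a0 mFr mFi bFr bFi F0.
pose f t := (1 + `|t| `^ (2 * alpha)) * (Fr t ^+ 2 + Fi t ^+ 2).
have f0 t : 0 <= f t by rewrite mulr_ge0 ?addr_ge0 ?powR_ge0 ?sqr_ge0.
have : mu.-integrable setT (EFin \o f).
  apply: (@integrable_bounded_support _ _ (- B) B
    ((1 + B `^ (2 * alpha)) * (M ^+ 2 + M ^+ 2))).
  - apply: measurable_funM; apply: measurable_funD => //.
    + apply: (measurableT_comp (measurable_powR _)); exact: normr_measurable.
    + exact: measurable_funX.
    + exact: measurable_funX.
  - move=> t /=; rewrite in_itv /= -ler_norml => tB.
    rewrite ger0_norm ?f0// /f; apply: ler_pM.
    + by rewrite addr_ge0 ?powR_ge0.
    + by rewrite addr_ge0 ?sqr_ge0.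
    + rewrite lerD2l; apply: ge0_ler_powR; rewrite ?mulr_ge0 ?nnegrE//.
      exact: le_trans tB.
    + have sq (v : R) : `|v| <= M -> v ^+ 2 <= M ^+ 2.
        by move=> vM; rewrite -[v ^+ 2]real_normK ?num_real// lerXn2r ?nnegrE// (le_trans _ vM).
      by apply: lerD; apply: sq.
  - by move=> t /F0[h1 h2]; rewrite /f h1 h2 expr0n /= addr0 mulr0.
move/integrableP => [_]; under eq_integral do rewrite /= ger0_norm//.
by [].
Qed.

(** Successive approximation starts from the indicator of x0. The sums [exppoly (Q n)] converge
    uniformly to a bounded hr + i hi, and the spectrum obtained by multiplying it with [kernel bs]
    gives an f equal to 1 at x0 and 0 on L. *)
Lemma not_uniqueness_of_kernel (gamma : nat -> R) (bs : seq R) (L : set R) delta alpha x0 :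
  0 <= alpha -> bs != [::] -> (forall b, b \in bs -> range gamma b) ->
  (forall s : seq R, uniq s ->
      (forall x y, x \in s -> y \in s -> x != y -> delta <= `|x - y|) ->
      (forall y, y \in s -> delta <= `|y|) ->
      \sum_(y <- s) cnorm1 (kernelFT bs y) <= 2^-1) ->
  (forall x y, (x0 |` L) x -> (x0 |` L) y -> x != y -> delta <= `|x - y|) ->
  ~ L x0 -> ~ uniqueness_set alpha (setS gamma) L.
Proof.
move=> a0 bs0 bsG Hbs sep Lx0.
pose r x : R[i] := if x == x0 then 1 else 0.
have r1 : l1_le (x0 |` L) r 1.
  move=> s us _; rewrite (bigID (pred1 x0)) /= [X in _ + X]big1 ?addr0; last first.
    by move=> x xx0; rewrite /r (negbTE xx0) cnorm10.
  rewrite (eq_bigr (fun _ => 1)); last first.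
    by move=> x /= xx0; rewrite /r xx0 /cnorm1 /= normr0 normr1 addr0.
  rewrite big_const_seq iter_addr_0 (_ : 1 = 1%:R)// ler_nat.
  by rewrite count_uniq_mem// leq_b1.
have [Q [Q0 Qr Qt]] := l1_iteration (kernelFT0 bs0) sep Hbs r1.
(* [P] stands for the real or the imaginary part. *)
have Qlim (P : R[i] -> R) : (forall z w, P (z - w) = P z - P w) ->
    (forall z, `|P z| <= cnorm1 z) ->
    exists h : R -> R, forall t n, `|h t - P (exppoly (Q n) t)| <= 8 * (3 / 4) ^+ n.
  move=> PB PN.
  have /choice[h Hh] t : exists l, forall n, `|l - P (exppoly (Q n) t)| <= 8 * (3 / 4) ^+ n.
    apply: geometric_increments_cvg => n.
    by rewrite -PB; apply: (le_trans (PN _)).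
  by exists h.
have [hr Hr] : exists h : R -> R, forall t n,
    `|h t - Re (exppoly (Q n) t)| <= 8 * (3 / 4) ^+ n.
  by apply: Qlim => [[? ?] [? ?]//|z]; rewrite lerDl.
have [hi Hi] : exists h : R -> R, forall t n,
    `|h t - Im (exppoly (Q n) t)| <= 8 * (3 / 4) ^+ n.
  by apply: Qlim => [[? ?] [? ?]//|z]; rewrite lerDr.
(* The factor at x = 0 brings [exppoly] to the form whose parts are known to be measurable. *)
have Emul n t : exppoly (Q n) t = exppoly (Q n) t * cexp (t * 0).
  by rewrite mulr0 cexp0 mulr1.
have cvgh (P : R[i] -> R) (h : R -> R) t :
    (forall n, `|h t - P (exppoly (Q n) t)| <= 8 * (3 / 4) ^+ n) ->
    (fun n => P (exppoly (Q n) t)) @ \oo --> h t.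
  move=> H; apply/cvgrPdist_le => e e0; near=> n.
  by apply: (le_trans (H n)); near: n; apply: geometric_small.
have mhr : measurable_fun setT hr.
  apply: (@measurable_fun_cvg _ _ _ _ (fun n t => Re (exppoly (Q n) t))).
    move=> n; under eq_fun do rewrite Emul; exact: (measurable_exppoly_cexp _ _).1.
  by move=> t _; apply: cvgh.
have mhi : measurable_fun setT hi.
  apply: (@measurable_fun_cvg _ _ _ _ (fun n t => Im (exppoly (Q n) t))).
    move=> n; under eq_fun do rewrite Emul; exact: (measurable_exppoly_cexp _ _).2.
  by move=> t _; apply: cvgh.
(* At n = 0 the combination is empty, so the limit is within 8 of 0. *)
have bhr t : `|hr t| <= 8.
  by have := Hr t 0%N; rewrite Q0 /exppoly big_nil subr0 expr0 mulr1.
have bhi t : `|hi t| <= 8.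
  by have := Hi t 0%N; rewrite Q0 /exppoly big_nil subr0 expr0 mulr1.
have [B HB] := kernel_support bs.
pose G := kernel bs.
pose Fr t := G t * hr t; pose Fi t := G t * hi t.
have mFr : measurable_fun setT Fr by apply: measurable_funM => //; apply: measurable_kernel.
have mFi : measurable_fun setT Fi by apply: measurable_funM => //; apply: measurable_kernel.
have bF t (h : R) : `|h| <= 8 -> `|G t * h| <= 48.
  move=> h8; rewrite normrM (_ : 48 = 6 * 8); last by ring.
  by apply: ler_pM => //; apply: kernel_bounded.
pose fr x := Rintegral mu setT
   (fun t => Fr t * cos (2 * pi * t * x) - Fi t * sin (2 * pi * t * x)).
pose fi x := Rintegral mu setT
   (fun t => Fr t * sin (2 * pi * t * x) + Fi t * cos (2 * pi * t * x)).
have inW : in_W alpha (setS gamma) fr fi.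
  exists Fr, Fi; split => //; split => //; split; last split => //.
  - apply: (@powR_bounded_integrable_lty _ B 48) => //.
    + by move=> t; apply: bF.
    + by move=> t; apply: bF.
    + by move=> t tB; rewrite /Fr /Fi /G HB// !mul0r.
  - apply: aeW => t St; rewrite /Fr /Fi /G kernel_out ?mul0r//.
    by move=> b /bsG[j _ <-] bt; apply: St; exists j.
(* Here 96 = 6 * (8 + 8): the kernel is at most 6, and hr and hi differ from the parts of
   [exppoly (Q n)] by at most 8 (3/4)^n each. *)
have close x n : `|fr x - Re (translates (kernelFT bs) (Q n) x)| <=
      96 * (3 / 4) ^+ n * fine (mu `[- B, B]) /\
    `|fi x - Im (translates (kernelFT bs) (Q n) x)| <=
      96 * (3 / 4) ^+ n * fine (mu `[- B, B]).
  have [i1 i2 <- <-] := Rintegral_kernel_exppoly (Q n) x bs0.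
  have mc := measurable_cos_freq x; have ms := measurable_sin_freq x.
  have bcs t (v w : R) : `|v| <= 1 -> `|w| <= 1 ->
      `|Fr t * v + Fi t * w| <= 96.
    move=> v1 w1; apply: (le_trans (ler_normD _ _)).
    rewrite (normrM (Fr t)) (normrM (Fi t)) (_ : 96 = 48 * 1 + 48 * 1); last by ring.
    by apply: lerD; apply: ler_pM => //; apply: bF.
  have if1 : mu.-integrable setT (EFin \o (fun t =>
      Fr t * cos (2 * pi * t * x) - Fi t * sin (2 * pi * t * x))).
    apply: (@integrable_bounded_support _ _ (- B) B 96).
    - by apply: measurable_funB; apply: measurable_funM.
    - by move=> t _; rewrite -mulrN; apply: bcs; rewrite ?normrN ?cos_max ?sin_max.
    - by move=> t tB; rewrite /Fr /Fi /G HB// !mul0r subrr.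
  have if2 : mu.-integrable setT (EFin \o (fun t =>
      Fr t * sin (2 * pi * t * x) + Fi t * cos (2 * pi * t * x))).
    apply: (@integrable_bounded_support _ _ (- B) B 96).
    - by apply: measurable_funD; apply: measurable_funM.
    - by move=> t _; apply: bcs; rewrite ?cos_max ?sin_max.
    - by move=> t tB; rewrite /Fr /Fi /G HB// !mul0r addr0.
  have [mR mI] := measurable_exppoly_cexp (Q n) x.
  have bd (g a b v w : R) (e := 8 * (3 / 4) ^+ n) : `|g| <= 6 -> `|a| <= e ->
      `|b| <= e -> `|v| <= 1 -> `|w| <= 1 -> `|g * (a * v + b * w)| <= 96 * (3 / 4) ^+ n.
    move=> g6 ae be v1 w1; rewrite normrM.
    rewrite (_ : 96 * _ = 6 * (e * 1 + e * 1)); last by rewrite /e; ring.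
    apply: ler_pM => //; apply: (le_trans (ler_normD _ _)).
    by rewrite !normrM; apply: lerD; apply: ler_pM.
  rewrite -!RintegralB//; split; apply: Rintegral_bounded_support_le.
  - apply: measurable_funB; first by apply: measurable_funB; apply: measurable_funM.
    by apply: measurable_funM => //; apply: measurable_kernel.
  - move=> t _; rewrite (_ : _ - _ = G t * ((hr t - Re (exppoly (Q n) t)) *
       cos (2 * pi * t * x) + (hi t - Im (exppoly (Q n) t)) * - sin (2 * pi * t * x))).
      by apply: bd; rewrite ?normrN ?cos_max ?sin_max//; apply: kernel_bounded.
    rewrite /Fr /Fi /cexp !mulrA; case: (exppoly _ _) => u v /=; rewrite /G; ring.
  - by move=> t tB; rewrite /Fr /Fi /G HB// !mul0r !subr0.
  - apply: measurable_funB; first by apply: measurable_funD; apply: measurable_funM.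
    by apply: measurable_funM => //; apply: measurable_kernel.
  - move=> t _; rewrite (_ : _ - _ = G t * ((hr t - Re (exppoly (Q n) t)) *
       sin (2 * pi * t * x) + (hi t - Im (exppoly (Q n) t)) * cos (2 * pi * t * x))).
      by apply: bd; rewrite ?cos_max ?sin_max//; apply: kernel_bounded.
    rewrite /Fr /Fi /cexp !mulrA; case: (exppoly _ _) => u v /=; rewrite /G; ring.
  - by move=> t tB; rewrite /Fr /Fi /G HB// !mul0r addr0 subr0.
(* Both f and r are geometrically close to the same combination of translates; the added 1 is the
   residual (3/4)^n of the n-th combination. *)
have val x : (x0 |` L) x -> fr x = Re (r x) /\ fi x = Im (r x).
  move=> Lx; split; apply: (@eq_geometric_close (96 * fine (mu `[- B, B]) + 1)) => n;
    have [c1 c2] := close x n; have := Qr n x Lx; rewrite /cnorm1;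
    move: c1 c2; case: (r x) (translates _ _ _) => [u1 u2] [v1 v2] /= c1 c2 c3.
  - have := ler_normB (fr x - v1) (u1 - v1); rewrite (_ : _ - _ - _ = fr x - u1); last by ring.
    have := normr_ge0 (u2 - v2); lra.
  - have := ler_normB (fi x - v2) (u2 - v2); rewrite (_ : _ - _ - _ = fi x - u2); last by ring.
    have := normr_ge0 (u1 - v1); lra.
move=> /(_ fr fi inW) H.
have [x Lx|+ _] := H _ x0.
  have xx0 : x != x0 by apply/eqP => xx0; rewrite xx0 in Lx.
  by have [|-> ->] := val x; [right|rewrite /r (negbTE xx0)].
have [|-> _] := val x0; first by left.
by rewrite /r eqxx /=; apply/eqP; rewrite oner_eq0.
Unshelve. all: by end_near.
Qed.

End NonUniqueness.

Theorem theorem7 (R : realType) (gamma : nat -> R) :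
  (forall j : nat, 2 <= gamma j.+1 - gamma j - 1 <= 3) ->
  propC (range gamma) ->
  forall alpha : R, 1 / 2 < alpha ->
  forall L : set R, uniformly_discrete L ->
  ~ uniqueness_set alpha (setS gamma) L.
Proof.
move=> _ GC alpha a12 L [delta [d0 sepL]].
(* A point of L moved by delta / 2, or 0 when L is empty; adjoining it to L keeps the separation
   delta / 2. *)
have [x0 Lx0 sep] : exists2 x0, ~ L x0 & forall y, L y -> delta / 2 <= `|y - x0|.
  have [->|/set0P[l Ll]] := eqVneq L set0; first by exists 0.
  have far y : L y -> delta / 2 <= `|y - (l + delta / 2)|.
    move=> Ly; have [->|yl] := eqVneq y l.
      by rewrite opprD addrA subrr sub0r normrN ger0_norm//; lra.
    have := sepL _ _ Ly Ll yl; have := ler_normD (y - (l + delta / 2)) (delta / 2).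
    rewrite (_ : y - (l + delta / 2) + delta / 2 = y - l); last by ring.
    by rewrite (ger0_norm (_ : 0 <= delta / 2)); lra.
  exists (l + delta / 2) => // /far; rewrite subrr normr0; lra.
have e0 : 0 < delta / 2 by lra.
have [bs [bs0 bsG Hbs]] := propC_kernel GC e0.
apply: (@not_uniqueness_of_kernel _ gamma bs L (delta / 2) alpha x0) => //; first lra.
move=> x y [->|Lx] [->|Ly]; rewrite ?eqxx// => xy.
- by rewrite distrC; apply: sep.
- exact: sep.
- by have := sepL _ _ Lx Ly xy; lra.
Qed.
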